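(* Let $(\mathcal P_n)_{n\ge 1}$ be a sequence of point sets $\mathcal P_n\subset\mathbb R^2$ with $|\mathcal P_n|=n$ and $D(\mathcal P_n)=o(n)$ as $n\to\infty$. Then no circle contains $\Omega(n^{5/6})$ points of $\mathcal P_n$; that is, for every constant $c>0$ there exists $n_0$ such that for all $n\ge n_0$ there is no circle $C\subset\mathbb R^2$ with $|\mathcal P_n\cap C|\ge c\,n^{5/6}$.
   Context: For a finite set $\mathcal P\subset\mathbb R^2$, $D(\mathcal P)$ denotes the number of distinct Euclidean distances determined by pairs of points of $\mathcal P$. *)

(* Defs.v *)
From HB Require Import structures.
From mathcomp Require Import all_boot all_order all_algebra finmap.
From mathcomp Require Import all_classical all_reals all_analysis.
Set Implicit Arguments.
Unset Strict Implicit.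
Unset Printing Implicit Defensive.
Import Order.TTheory GRing.Theory Num.Theory.
Import numFieldNormedType.Exports.
Local Open Scope classical_set_scope.
Local Open Scope ring_scope.
Local Open Scope fset_scope.

(* The norm that the library puts on R * R is the sup norm, hence an explicit
   Euclidean distance. *)
Definition eucl_dist (R : realType) (p q : R * R) : R :=
  Num.sqrt ((p.1 - q.1) ^+ 2 + (p.2 - q.2) ^+ 2).

(* Only pairs of distinct points count, so 0 is not a distance. *)
Definition distances (R : realType) (P : {fset R * R}) : {fset R} :=
  [fset eucl_dist p q | p in P, q in [fset q in P | q != p]].

Definition num_distances (R : realType) (P : {fset R * R}) : nat :=
  #|` distances P|.

(* A circle for 0 < r only; this is imposed where circles are used. *)
Definition circle (R : realType) (o : R * R) (r : R) : set (R * R) :=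
  [set p | eucl_dist p o = r].

Definition num_points_on (R : realType) (P : {fset R * R}) (C : set (R * R))
  : nat := #|` [fset p in P | p \in C]|.

(* Main.v *)
Require Import Defs.
From HB Require Import structures.
From mathcomp Require Import all_boot all_order all_algebra.
From mathcomp Require Import zify ring lra.
Set Implicit Arguments.
Unset Strict Implicit.
Unset Printing Implicit Defensive.
Import Order.TTheory GRing.Theory Num.Theory.
Local Open Scope ring_scope.

(* Put the centre of the circle at the origin, let [A] be the [m] points of an
   open half circle, and [D] the number of distances.  By Cauchy-Schwarz there
   are at least (mn)^2/(D+1) quadruples (a, b, p, q) with a, b in [A] and
   |ap| = |bq|, that is, p.a - q.b = (|p|^2 - |q|^2)/2.  Those with |p| = |q|
   are at most 2m^2n in number, as a, b and p leave two choices for q.  For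
   |p| <> |q| they are incidences between the m x m grid A x A and the curve of
   the pair (p, q), which is the section of the product of two circles in R^4
   by a hyperplane.  Cut [A] into r consecutive blocks of at most k points.  A
   curve consists of four monotone pieces, so it meets at most 8r of the r^2
   cells.  Two hyperplane sections share at most 8 points; hence more than 8
   points of a curve span the whole hyperplane, and each of them starts a
   quadruple of points which determines the hyperplane, hence (p, q).  A cell
   has k^8 quadruples, so the incidences are at most 64rn^2 + r^2k^8.  Taking
   k about n^(1/6) gives D >= const * n when m >= const * n^(5/6). *)

(** * Dot and cross products of points on a circle *)

Section Plane.
Variable R : realFieldType.
Implicit Types (u v w a b p q : R * R).

Definition dot u v : R := u.1 * v.1 + u.2 * v.2.
Definition cross u v : R := u.1 * v.2 - u.2 * v.1.
Definition sqdist u v : R := (u.1 - v.1) ^+ 2 + (u.2 - v.2) ^+ 2.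

Lemma dot_self_gt0 u : u != 0 -> 0 < dot u u.
Proof.
case: u => x y; rewrite xpair_eqE negb_and /dot /= => /orP h.
have h1 : 0 <= x * x by rewrite -expr2 sqr_ge0.
have h2 : 0 <= y * y by rewrite -expr2 sqr_ge0.
case: h => h.
  by rewrite ltr_pwDl // lt_def h1 mulf_neq0.
by rewrite ltr_pwDr // lt_def h2 mulf_neq0.
Qed.

(** The two equations are linear in [u - v], with determinant [dot w w]. *)
Lemma dot_cross_inj w u v :
  w != 0 -> dot w u = dot w v -> cross w u = cross w v -> u = v.
Proof.
move=> /dot_self_gt0 /lt0r_neq0 w0 hd hc.
have e : dot w w * (u.1 - v.1) = 0 /\ dot w w * (u.2 - v.2) = 0.
  move: hd hc; rewrite /dot /cross => hd hc.
  have -> : (w.1 * w.1 + w.2 * w.2) * (u.1 - v.1) =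
    w.1 * ((w.1 * u.1 + w.2 * u.2) - (w.1 * v.1 + w.2 * v.2))
    - w.2 * ((w.1 * u.2 - w.2 * u.1) - (w.1 * v.2 - w.2 * v.1)) by ring.
  have -> : (w.1 * w.1 + w.2 * w.2) * (u.2 - v.2) =
    w.2 * ((w.1 * u.1 + w.2 * u.2) - (w.1 * v.1 + w.2 * v.2))
    + w.1 * ((w.1 * u.2 - w.2 * u.1) - (w.1 * v.2 - w.2 * v.1)) by ring.
  by rewrite hd hc; split; ring.
case: e => /eqP; rewrite mulf_eq0 (negPf w0) subr_eq0 /= => /eqP e1.
move=> /eqP; rewrite mulf_eq0 (negPf w0) subr_eq0 /= => /eqP e2.
by case: u v e1 e2 {hd hc} => [? ?] [? ?] /= -> ->.
Qed.

Lemma dot_cross_sqr w u : dot w u ^+ 2 + cross w u ^+ 2 = dot w w * dot u u.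
Proof. rewrite /dot /cross; ring. Qed.

(** A line meets a circle at most twice: by [dot_cross_sqr], the norm and [dot w] fix [cross w] up
    to sign, and two of three points agree in that sign. *)
Lemma line_circle w u1 u2 u3 : w != 0 ->
  dot u1 u1 = dot u2 u2 -> dot u2 u2 = dot u3 u3 ->
  dot w u1 = dot w u2 -> dot w u2 = dot w u3 ->
  [\/ u1 = u2, u2 = u3 | u3 = u1].
Proof.
move=> w0 n12 n23 d12 d23.
have := dot_cross_sqr w u1; have := dot_cross_sqr w u2.
have := dot_cross_sqr w u3; rewrite n12 n23 d12 d23 => e3 e2 e1.
have c12 : cross w u1 ^+ 2 = cross w u2 ^+ 2 by lra.
have c23 : cross w u2 ^+ 2 = cross w u3 ^+ 2 by lra.
move/eqP: c12; rewrite eqf_sqr => /orP[] /eqP c12.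
  by apply: Or31; apply: (dot_cross_inj w0).
move/eqP: c23; rewrite eqf_sqr => /orP[] /eqP c23.
  by apply: Or32; apply: (dot_cross_inj w0).
apply: Or33; apply: (dot_cross_inj w0); first by rewrite d12 d23.
by rewrite c12 c23 opprK.
Qed.

(* On a circle, the chord from [a] to [b] is orthogonal to [a + b], so the
   ratio of the increments of [dot p] and of the abscissa is the ratio of
   [cross p (a + b)] and the ordinate of [a + b]. *)
Lemma dot_increment p a b : dot a a = dot b b ->
  (b.1 - a.1) * (cross p a + cross p b) = (dot p b - dot p a) * (a.2 + b.2).
Proof.
rewrite /dot /cross => e.
suff : (b.1 - a.1) * (p.1 * a.2 - p.2 * a.1 + (p.1 * b.2 - p.2 * b.1))
  - (p.1 * b.1 + p.2 * b.2 - (p.1 * a.1 + p.2 * a.2)) * (a.2 + b.2) =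
  p.2 * (a.1 * a.1 + a.2 * a.2 - (b.1 * b.1 + b.2 * b.2)).
  by rewrite e subrr mulr0 => /eqP; rewrite subr_eq0 => /eqP.
ring.
Qed.

(** The sign of the increment is read off [dot_increment]. This and [dot_gt] make the pieces of a
    curve monotone. *)
Lemma dot_lt p a b : p != 0 -> dot a a = dot b b -> 0 < a.2 -> 0 < b.2 ->
  a.1 < b.1 -> 0 <= cross p a -> 0 <= cross p b -> dot p a < dot p b.
Proof.
move=> p0 e ha hb hab ca cb.
have h := dot_increment p e.
have y0 : 0 < a.2 + b.2 by lra.
have x0 : 0 < b.1 - a.1 by lra.
have le : 0 <= dot p b - dot p a.
  by rewrite -(pmulr_lge0 _ y0) -h mulr_ge0 ?(ltW x0) // addr_ge0.
rewrite -subr_gt0 lt_def le andbT; apply/eqP => e0.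
(* A zero increment makes both nonnegative cross products vanish, so that [a = b]. *)
move: h; rewrite e0 mul0r => /eqP; rewrite mulf_eq0 (gt_eqF x0) /= => /eqP s0.
have : a = b by apply: (dot_cross_inj p0); lra.
by move=> eab; move: x0; rewrite eab subrr ltxx.
Qed.

Lemma dot_gt p a b : p != 0 -> dot a a = dot b b -> 0 < a.2 -> 0 < b.2 ->
  a.1 < b.1 -> cross p a < 0 -> cross p b < 0 -> dot p b < dot p a.
Proof.
move=> p0 e ha hb hab ca cb.
have : dot (- p) a < dot (- p) b.
  apply: dot_lt; rewrite ?oppr_eq0 //; rewrite /cross /= in ca cb *; lra.
by rewrite /dot /=; lra.
Qed.
End Plane.

(** * Elementary counting *)

Lemma size_le_fibers (T U : eqType) (f : T -> U) (s : seq T) (d : nat) :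
  (forall u, (count (fun x => f x == u) s <= d)%N) ->
  (size s <= d * size (undup [seq f x | x <- s]))%N.
Proof.
move=> h.
have -> : size s = (\sum_(u <- undup (map f s)) count (fun x => f x == u) s)%N.
  under eq_bigr do rewrite -sum1_count big_mkcond /=.
  rewrite exchange_big /= -sum1_size; apply: eq_big_seq => x xs.
  rewrite -big_mkcond /= sum1_count -(eq_count (a1 := pred1 (f x))) //.
  by rewrite count_uniq_mem ?undup_uniq // mem_undup map_f.
rewrite mulnC -sum1_size big_distrl /=; apply: leq_sum => u _.
by rewrite mul1n.
Qed.

Lemma card_le2 (T : finType) (S : {set T}) :
  (forall x y z, x \in S -> y \in S -> z \in S -> [\/ x = y, y = z | z = x]) ->
  (#|S| <= 2)%N.
Proof.
move=> h; rewrite leqNgt; apply/negP => /card_gt2P [x [y [z [[xS yS zS]]]]].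
by case: (h x y z xS yS zS) => ->; rewrite eqxx //= => -[].
Qed.

(** * Hyperplane sections of a product of two circles *)

Section Sections.
Variable R : realFieldType.

(** Substituting [y ^ 2 = rho - x ^ 2] and squaring away the remaining [y] leaves a polynomial [P]
    of degree at most 4 in the abscissa. A vertical line meets the circle at most twice, so more
    than 8 points have more than 4 abscissae, and [P] is zero. *)
Lemma quadratic_circle_eq0 (us : seq (R * R)) (rho c0 c1 c2 c3 c4 c5 : R) :
  uniq us -> (8 < size us)%N ->
  (forall u, u \in us -> dot u u = rho /\
     c0 + c1 * u.1 + c2 * u.2 + c3 * u.1 ^+ 2 + c4 * u.1 * u.2 + c5 * u.2 ^+ 2
     = 0) ->
  [/\ c1 = 0, c2 = 0, c3 = c5 & c4 = 0].
Proof.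
move=> us_uniq us_size usP.
pose d0 := c0 + c5 * rho; pose d3 := c3 - c5.
pose e4 := d3 ^+ 2 + c4 ^+ 2.
pose e3 := 2 * c1 * d3 + 2 * c2 * c4.
pose e2 := c1 ^+ 2 + 2 * d0 * d3 - rho * c4 ^+ 2 + c2 ^+ 2.
pose e1 := 2 * d0 * c1 - 2 * rho * c2 * c4.
pose e0 := d0 ^+ 2 - rho * c2 ^+ 2.
pose P := Poly [:: e0; e1; e2; e3; e4].
pose xs := undup [seq u.1 | u <- us].
have xs_size : (4 < size xs)%N.
  have := @size_le_fibers _ _ (fun u : R * R => u.1) us 2 _.
  rewrite -/xs => h.
  have : (size us <= 2 * size xs)%N; last by lia.
  apply: h => x; rewrite -size_filter.
  set s := filter _ _.
  have : uniq s by apply: filter_uniq.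
  have sP u : u \in s -> u.1 = x /\ dot u u = rho.
    by rewrite mem_filter => /andP[/eqP <- /usP[]].
  case: s sP => [|u1 [|u2 [|u3 s]]] // sP; rewrite /= !inE.
  have [x1 n1] := sP u1 (mem_head _ _).
  have [x2 n2] : u2.1 = x /\ dot u2 u2 = rho by apply: sP; rewrite !inE eqxx orbT.
  have [x3 n3] : u3.1 = x /\ dot u3 u3 = rho by apply: sP; rewrite !inE eqxx !orbT.
  have w0 : ((1, 0) : R * R) != 0 by rewrite xpair_eqE oner_eq0.
  have := @line_circle R (1, 0) u1 u2 u3 w0.
  rewrite n1 n2 n3 => /(_ erefl erefl); rewrite {1 2 3 4}/dot /= x1 x2 x3.
  rewrite !mul0r => /(_ erefl erefl) [] ->; by rewrite eqxx ?orbT ?andbF.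
have P0 : P = 0.
  apply/eqP; apply: contraT => P0.
  have : (size xs < size P)%N.
    apply: max_poly_roots => //; last exact: undup_uniq.
    apply/allP => x; rewrite mem_undup => /mapP [u /usP [n e] ->].
    rewrite /root /P horner_Poly /= mul0r !add0r.
    move: n e; rewrite /dot; case: u => {}x y /= n e.
    have ey : y * y = rho - x * x by rewrite -n; ring.
    have e' : d0 + c1 * x + d3 * x ^+ 2 = - (y * (c2 + c4 * x)).
      apply/eqP; rewrite -subr_eq0 opprK; apply/eqP; rewrite -[RHS]e /d0 /d3 -n.
      by ring.
    apply/eqP; transitivity ((d0 + c1 * x + d3 * x ^+ 2) ^+ 2
       - (rho - x * x) * (c2 + c4 * x) ^+ 2).
      by rewrite /e0 /e1 /e2 /e3 /e4; ring.
    by rewrite e' -ey; ring.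
  by move=> h; move: (leq_trans h (size_Poly _)); rewrite ltnS leqNgt xs_size.
have coef i : [:: e0; e1; e2; e3; e4]`_i = 0 by rewrite -coef_Poly -/P P0 coef0.
have sqr_add0 (x y : R) : x ^+ 2 + y ^+ 2 = 0 -> x = 0 /\ y = 0.
  by move/eqP; rewrite paddr_eq0 ?sqr_ge0 // !sqrf_eq0 => /andP[/eqP -> /eqP ->].
(* The coefficient of degree 4 is a sum of two squares; once these vanish, so is the coefficient of
   degree 2. *)
have [d3_0 c4_0] := sqr_add0 _ _ (coef 4).
have [c1_0 c2_0] : c1 = 0 /\ c2 = 0.
  apply: sqr_add0; rewrite -(coef 2) /= /e2 d3_0 c4_0; ring.
by split=> //; move: d3_0; rewrite /d3; lra.
Qed.

(* Two distinct hyperplane sections of the torus, product of two circles of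
   squared radius [rho] in the plane, share at most 8 points when one of them
   has the shape [dot p a - dot q b = t] with [p], [q] and [t] nonzero. *)
Lemma hyperplane_sections (s : seq ((R * R) * (R * R))) (rho : R)
    (p q : R * R) (t : R) (A B : R * R) (E : R) :
  p != 0 -> q != 0 -> t != 0 -> uniq s -> (8 < size s)%N ->
  (forall ab, ab \in s ->
     [/\ dot ab.1 ab.1 = rho, dot ab.2 ab.2 = rho,
         dot p ab.1 - dot q ab.2 = t & E + dot A ab.1 + dot B ab.2 = 0]) ->
  exists mu, [/\ E = - mu * t, A = (mu * p.1, mu * p.2)
               & B = (- mu * q.1, - mu * q.2)].
Proof.
move=> p0 q0 t0 s_uniq s_size sP.
have q2 := lt0r_neq0 (dot_self_gt0 q0).
have p2 := lt0r_neq0 (dot_self_gt0 p0).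
(* [B] has coordinates [- mu] and [D] along [q] and its rotation by a right angle. Subtracting [mu]
   times the equation of the first section from the second cancels the part along [q]. *)
pose mu := - dot B q / dot q q.
pose E1 := E + mu * t.
pose A1 : R * R := (A.1 - mu * p.1, A.2 - mu * p.2).
pose D := cross q B / dot q q.
have eB : B = (- mu * q.1 - D * q.2, - mu * q.2 + D * q.1).
  move: q2; rewrite /mu /D /dot /cross; case: (B) (q) => [B1 B2] [q1 q2] /= q2n.
  by congr (_, _); field.
have sP1 ab : ab \in s -> E1 + dot A1 ab.1 + D * cross q ab.2 = 0.
  move=> /sP [_ _ e <-].
  rewrite /E1 /A1 -e eB /dot /cross /=; ring.
suff [E0 A0 D0] : [/\ E1 = 0, A1 = 0 & D = 0].
  exists mu; split.
  - by move: E0; rewrite /E1; lra.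
  - by case: A0; rewrite [A]surjective_pairing /=; move=> h1 h2; congr (_, _); lra.
  - by rewrite eB D0; congr (_, _); ring.
(* For nonzero [D], the point [a] determines both [dot q b] and [cross q b], hence [b]. *)
have fib a0 : D != 0 -> (count (fun ab => ab.1 == a0) s <= 1)%N.
  move=> D0; rewrite -size_filter.
  have : uniq [seq ab <- s | ab.1 == a0] by apply: filter_uniq.
  set f := filter _ _.
  have fP ab : ab \in f -> ab.1 = a0 /\ ab \in s.
    by rewrite mem_filter => /andP[/eqP].
  case: f fP => [|[a b] [|[a' b'] f]] // fP; rewrite /= !inE.
  have [/= ea /[dup] /sP[/= _ _ h _] /sP1 /= h1] := fP _ (mem_head _ _).
  have [/= ea' /[dup] /sP[/= _ _ h' _] /sP1 /= h1'] :
    (a', b').1 = a0 /\ (a', b') \in s by apply: fP; rewrite !inE eqxx orbT.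
  suff : b = b' by move=> ->; rewrite ea ea' eqxx.
  apply: (dot_cross_inj q0); rewrite ?ea ?ea' in h h' h1 h1'; first by lra.
  by apply: (mulfI D0); lra.
pose us := undup [seq ab.1 | ab <- s].
case: (eqVneq D 0) => [D0|D0].
  (* For [D = 0], each [a] comes with at most two [b], so at least three points [a] of the circle
     satisfy [E1 + dot A1 a = 0], which therefore is not the equation of a line. *)
  have us_size : (2 < size us)%N.
    have h : (size s <= 2 * size us)%N; last by lia.
    apply: size_le_fibers => a0; rewrite -size_filter.
    have : uniq [seq ab <- s | ab.1 == a0] by apply: filter_uniq.
    set f := filter _ _.
    have fP ab : ab \in f ->
        [/\ ab.1 = a0, dot ab.2 ab.2 = rho & dot q ab.2 = dot p a0 - t].
      by rewrite mem_filter => /andP[/eqP <- /sP [_ ? h _]]; split => //; lra.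
    case: f fP => [|[a b] [|[a' b'] [|[a'' b''] f]]] // fP; rewrite /= !inE.
    have [/= -> n d] := fP _ (mem_head _ _).
    have [/= -> n' d'] := fP (a', b') ltac:(by rewrite !inE eqxx orbT).
    have [/= -> n'' d''] := fP (a'', b'') ltac:(by rewrite !inE eqxx !orbT).
    have := @line_circle R q b b' b'' q0; rewrite n n' n'' d d' d''.
    by move=> /(_ erefl erefl erefl erefl) [] ->; rewrite eqxx ?orbT ?andbF.
  have usP u : u \in us -> dot u u = rho /\ E1 + dot A1 u = 0.
    rewrite mem_undup => /mapP [ab abs ->]; split; first by case: (sP _ abs).
    by have := sP1 _ abs; rewrite D0 mul0r addr0.
  have : uniq us by apply: undup_uniq.
  case: us us_size usP => [|u1 [|u2 [|u3 us]]] //= _ usP.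
  have [n1 l1] := usP u1 (mem_head _ _).
  have [n2 l2] := usP u2 ltac:(by rewrite !inE eqxx orbT).
  have [n3 l3] := usP u3 ltac:(by rewrite !inE eqxx !orbT).
  case: (eqVneq A1 0) => [A0|A0].
    by move: l1; rewrite A0 /dot /= !mul0r !addr0.
  have := @line_circle R A1 u1 u2 u3 A0; rewrite n1 n2 n3 => /(_ erefl erefl).
  have -> : dot A1 u1 = - E1 by lra.
  have -> : dot A1 u2 = - E1 by lra.
  have -> : dot A1 u3 = - E1 by lra.
  by rewrite !inE => /(_ erefl erefl) [] ->; rewrite eqxx ?orbT ?andbF.
have us_size : (8 < size us)%N.
  apply: leq_trans s_size _; rewrite -[X in (_ <= X)%N]mul1n.
  by apply: size_le_fibers => a0; apply: fib.
(* Coordinates of [A1] along [p] and its rotation. Eliminating [b] through [dot_cross_sqr q b] puts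
   the more than 8 points [(dot p a, cross p a)] on a conic as well as on a circle. *)
pose al := dot A1 p / dot p p; pose be := cross p A1 / dot p p.
pose vs := [seq (dot p u, cross p u) | u <- us].
have vs_uniq : uniq vs.
  rewrite map_inj_uniq ?undup_uniq // => u v [h1 h2].
  exact: (dot_cross_inj p0).
have [] := @quadratic_circle_eq0 vs (dot p p * rho)
  (E1 ^+ 2 + D ^+ 2 * t ^+ 2 - D ^+ 2 * (dot q q * rho))
  (2 * E1 * al - 2 * D ^+ 2 * t) (2 * E1 * be) (al ^+ 2 + D ^+ 2)
  (2 * al * be) (be ^+ 2) vs_uniq _ _.
- by rewrite size_map.
- move=> v /mapP [u]; rewrite mem_undup => /mapP [[a b] abs /= -> -> /=].
  have [/= na nb h _] := sP _ abs; have /= h1 := sP1 _ abs.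
  split; first by rewrite -na /dot /cross /=; ring.
  have eA : dot A1 a = al * dot p a + be * cross p a.
    move: p2; rewrite /al /be /dot /cross => p2; by field.
  rewrite eA in h1.
  have cb := dot_cross_sqr q b; rewrite nb in cb.
  have eb : dot q b = dot p a - t by lra.
  rewrite -cb eb.
  transitivity ((E1 + al * dot p a + be * cross p a) ^+ 2
    - (D * cross q b) ^+ 2); first by ring.
  have -> : E1 + al * dot p a + be * cross p a = - (D * cross q b) by lra.
  by ring.
(* The coefficients give [be ^+ 2 = al ^+ 2 + D ^+ 2 > 0] and [al * be = 0], so [al = 0]; the linear
   coefficient then forces [D ^+ 2 * t = 0]. *)
- move=> c1 c2 c35 c4; exfalso.
  have D2 : 0 < D ^+ 2 by rewrite exprn_even_gt0.
  have be0 : be != 0.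
    by apply/eqP => be0; move: c35; rewrite be0 expr0n /=; nra.
  have al0 : al = 0.
    by apply: (mulIf be0); rewrite mul0r; lra.
  have /eqP : D ^+ 2 * t = 0 by move: c1; rewrite al0; lra.
  by rewrite mulf_eq0 (gt_eqF D2) (negPf t0).
Qed.
End Sections.

(** * Ranks and orthogonality of rows *)

Lemma mxrank_col_mx_gt (F : fieldType) (m n : nat) (U : 'M[F]_(m, n))
    (v : 'rV_n) :
  ~~ (v <= U)%MS -> (\rank U < \rank (col_mx v U))%N.
Proof.
apply: contraR; rewrite -leqNgt => h.
have UV : (U <= col_mx v U)%MS by rewrite -addsmxE addsmxSr.
have := (mxrank_leqif_sup UV).1; rewrite leq_eqVlt ltnNge h orbF.
rewrite (mxrank_leqif_sup UV).2; apply: submx_trans.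
by rewrite -addsmxE addsmxSl.
Qed.

(** If every [v x] lay in [U], all rows orthogonal to [U] would be orthogonal to every [v x] and so
    lie in the span of [h], leaving [U] corank at most 1. *)
Lemma exists_nsubmx (F : fieldType) (T : eqType) (m n : nat) (s : seq T)
    (v : T -> 'rV[F]_n) (h : 'rV[F]_n) (U : 'M[F]_(m, n)) :
  (forall h' : 'rV_n, (forall x, x \in s -> h' *m (v x)^T = 0) -> (h' <= h)%MS) ->
  (\rank U + 1 < n)%N -> exists2 x, x \in s & ~~ (v x <= U)%MS.
Proof.
move=> hh Un.
case: (boolP (has (fun x => ~~ (v x <= U)%MS) s)) => [/hasP //|/hasPn nh].
exfalso; suff : (kermx U^T <= h)%MS.
  move/mxrankS; rewrite mxrank_ker mxrank_tr => h1.
  by have := leq_trans h1 (rank_leq_row h); lia.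
apply/row_subP => i; apply: hh => x /nh; rewrite negbK => /submxP [D ->].
rewrite trmx_mul mulmxA; set w := row i _.
suff -> : w *m U^T = 0 by rewrite mul0mx.
by apply/sub_kermxP; apply: row_sub.
Qed.

Lemma submx_ker_corank1 (F : fieldType) (m n : nat) (U : 'M[F]_(m, n))
    (h h' : 'rV[F]_n) :
  h != 0 -> (n <= \rank U + 1)%N -> h *m U^T = 0 -> h' *m U^T = 0 ->
  (h' <= h)%MS.
Proof.
move=> h0 Un /sub_kermxP hU /sub_kermxP h'U.
apply: submx_trans h'U _.
rewrite -(mxrank_leqif_sup hU).2 eqn_leq (mxrank_leqif_sup hU).1 /=.
by rewrite mxrank_ker mxrank_tr rank_rV h0; lia.
Qed.

(** * Curves as hyperplanes in homogeneous coordinates *)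

Section Torus.
Variable R : realFieldType.
Local Notation point := (R * R)%type.
Implicit Types (p q a b : point) (x : point * point).

Definition row5 (x0 x1 x2 x3 x4 : R) : 'rV[R]_5 :=
  \row_(i < 5) [:: x0; x1; x2; x3; x4]`_i.

Lemma row5_dot (c0 c1 c2 c3 c4 d0 d1 d2 d3 d4 : R) :
  (row5 c0 c1 c2 c3 c4 *m (row5 d0 d1 d2 d3 d4)^T == 0) =
  (c0 * d0 + c1 * d1 + c2 * d2 + c3 * d3 + c4 * d4 == 0).
Proof.
set e := (X in (X == 0)); set r := (X in _ = (X == 0)).
have er : e 0 0 = r.
  by rewrite /e /r !mxE !big_ord_recr big_ord0 /= !mxE /= add0r.
apply/eqP/eqP => [e0|r0]; first by rewrite -er e0 mxE.
by apply/matrixP => i j; rewrite !ord1 er mxE.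
Qed.

Lemma row5E (v : 'rV[R]_5) :
  v = row5 (v 0 0) (v 0 1) (v 0 (inord 2)) (v 0 (inord 3)) (v 0 (inord 4)).
Proof.
apply/rowP => i; rewrite mxE.
case: i => [[|[|[|[|[|//]]]]] hi] /=; congr (v _ _); apply: val_inj => //=;
  by rewrite inordK.
Qed.

Lemma row5_scale (mu c0 c1 c2 c3 c4 : R) :
  mu *: row5 c0 c1 c2 c3 c4 =
  row5 (mu * c0) (mu * c1) (mu * c2) (mu * c3) (mu * c4).
Proof. by apply/rowP => -[[|[|[|[|[|//]]]]] hi]; rewrite !mxE. Qed.

Lemma row5_inj (c0 c1 c2 c3 c4 d0 d1 d2 d3 d4 : R) :
  row5 c0 c1 c2 c3 c4 = row5 d0 d1 d2 d3 d4 ->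
  [/\ c0 = d0, c1 = d1, c2 = d2, c3 = d3 & c4 = d4].
Proof.
move=> /rowP h.
by split; [move: (h (inord 0)) | move: (h (inord 1)) | move: (h (inord 2))
  | move: (h (inord 3)) | move: (h (inord 4))]; rewrite !mxE inordK.
Qed.

Definition gap p q : R := (dot p p - dot q q) / 2.

(* For [a] and [b] on a common circle centred at the origin, this says that
   [p] is as far from [a] as [q] is from [b]. *)
Definition incident p q x := dot p x.1 - dot q x.2 == gap p q.

Definition generic p q := [&& p != 0, q != 0 & gap p q != 0].

(** With a leading 1, the affine equation of a curve becomes orthogonality of two rows of length
    5. *)
Definition torus_row x := row5 1 x.1.1 x.1.2 x.2.1 x.2.2.
Definition curve_row p q := row5 (gap p q) (- p.1) (- p.2) q.1 q.2.

(** Rank 4 in dimension 5 leaves a single hyperplane through the four points. *)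
Definition independent x0 x1 x2 x3 :=
  (4 <= \rank (col_mx (torus_row x3) (col_mx (torus_row x2)
                 (col_mx (torus_row x1) (torus_row x0)))))%N.

Lemma incidentE p q x : incident p q x = (curve_row p q *m (torus_row x)^T == 0).
Proof.
rewrite row5_dot /incident /dot -subr_eq0 -oppr_eq0; congr (_ == _); ring.
Qed.

Lemma curve_row_neq0 p q : generic p q -> curve_row p q != 0.
Proof.
case/and3P=> _ _; apply: contraNneq => h.
have /row5_inj [-> _] // : curve_row p q = row5 0 0 0 0 0.
by rewrite h; apply/rowP => -[[|[|[|[|[|//]]]]] hi]; rewrite !mxE.
Qed.

(** Points are added greedily: as long as the rank is below 4, some point of [s] raises it. *)
Lemma independent_extend (s : seq (point * point)) (rho : R) p q x0 :
  generic p q -> uniq s -> (8 < size s)%N ->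
  (forall x, x \in s ->
     [/\ dot x.1 x.1 = rho, dot x.2 x.2 = rho & incident p q x]) ->
  exists x1 x2 x3,
    [/\ x1 \in s, x2 \in s, x3 \in s & independent x0 x1 x2 x3].
Proof.
move=> gpq s_uniq s_size sP.
(* By [hyperplane_sections], no other hyperplane contains all of [s]. *)
have key (h' : 'rV_5) : (forall x, x \in s -> h' *m (torus_row x)^T = 0) ->
    (h' <= curve_row p q)%MS.
  rewrite [h']row5E; move: (h' 0 0) (h' 0 1) (h' 0 (inord 2)) (h' 0 (inord 3)) (h' 0 (inord 4)).
  move=> E A1 A2 B1 B2 hs.
  case/and3P: gpq => p0 q0 t0.
  have [|mu [-> [-> ->] [-> ->]]] := hyperplane_sections (t := gap p q)
    (A := (A1, A2)) (B := (B1, B2)) (E := E) p0 q0 t0 s_uniq s_size (rho := rho).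
    move=> x xs; have [n1 n2 /eqP i] := sP _ xs; split=> //.
    move/eqP: (hs _ xs); rewrite row5_dot => /eqP <-.
    by rewrite /dot /=; ring.
  apply/sub_rVP; exists (- mu); rewrite row5_scale.
  by congr row5; ring.
have ext m (U : 'M_(m, 5)) : (\rank U + 1 < 5)%N ->
    exists2 x, x \in s & (\rank U < \rank (col_mx (torus_row x) U))%N.
  move=> /(exists_nsubmx key) [x xs h]; exists x => //.
  exact: mxrank_col_mx_gt.
have grow m (U : 'M_(m, 5)) k : (k < 4)%N -> (k <= \rank U)%N ->
    exists2 x, x \in s & (k < \rank (col_mx (torus_row x) U))%N.
  move=> k4 kU; case: (ltnP (\rank U + 1) 5) => [/ext [x xs h]|h].
    by exists x => //; apply: leq_ltn_trans kU h.
  case: s s_size {sP key ext s_uniq} => // x s _; exists x; first exact: mem_head.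
  apply: leq_trans (_ : \rank U <= _)%N; first by lia.
  by apply: mxrankS; rewrite -addsmxE addsmxSr.
have r0 : (1 <= \rank (torus_row x0))%N.
  rewrite rank_rV lt0b; apply/eqP => h.
  have : torus_row x0 0 0 = 0 by rewrite h mxE.
  by rewrite mxE /=; apply/eqP; rewrite oner_eq0.
have [x1 x1s r1] := grow _ _ 1 isT r0.
have [x2 x2s r2] := grow _ _ 2 isT r1.
have [x3 x3s r3] := grow _ _ 3 isT r2.
by exists x1, x2, x3.
Qed.

(* The four points determine the coefficient vector of the curve up to a
   scalar [mu]; since [gap] is quadratic and nonzero, [mu ^+ 2 = mu]. *)
Lemma independent_curve_unique x0 x1 x2 x3 p q p' q' :
  independent x0 x1 x2 x3 -> generic p q -> generic p' q' ->
  all (incident p q) [:: x0; x1; x2; x3] ->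
  all (incident p' q') [:: x0; x1; x2; x3] -> (p, q) = (p', q').
Proof.
move=> ind gpq gpq'; rewrite /= !incidentE !andbT.
move=> /and4P [/eqP h0 /eqP h1 /eqP h2 /eqP h3].
move=> /and4P [/eqP h0' /eqP h1' /eqP h2' /eqP h3'].
have : (curve_row p' q' <= curve_row p q)%MS.
  apply: submx_ker_corank1 (curve_row_neq0 gpq) _ _ _.
  - rewrite addn1 ltnS; exact: ind.
  - by rewrite !tr_col_mx !mul_mx_row h0 h1 h2 h3 !row_mx0.
  - by rewrite !tr_col_mx !mul_mx_row h0' h1' h2' h3' !row_mx0.
move=> /sub_rVP [mu]; rewrite row5_scale => /row5_inj [eg e1 e2 e3 e4].
have {}e1 : p'.1 = mu * p.1 by lra.
have {}e2 : p'.2 = mu * p.2 by lra.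
case/and3P: gpq => _ _ g0; case/and3P: gpq' => p'0 _ g'0.
have : (mu * gap p q) * (mu - 1) = 0.
  have : gap p' q' = mu ^+ 2 * gap p q.
    by rewrite /gap /dot e1 e2 e3 e4; field.
  by rewrite eg => h; rewrite mulrBr mulr1 [X in _ - X]h; ring.
rewrite -eg => /eqP; rewrite mulf_eq0 (negPf g'0) subr_eq0 /= => /eqP mu1.
move: e1 e2 e3 e4; rewrite mu1 !mul1r.
by case: p p' q q' {h0 h1 h2 h3 h0' h1' h2' h3' eg g0 p'0 g'0} =>
  [? ?] [? ?] [? ?] [? ?] /= -> -> -> ->.
Qed.
End Torus.

(** * Collisions, blocks and monotone sets of cells *)

Section Combinatorics.
Local Open Scope nat_scope.

Lemma card_le_fibers (T U : finType) (f : T -> U) (W : {set T}) (B : {set U})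
    (d : nat) :
  (forall x, x \in W -> f x \in B) ->
  (forall u, u \in B -> #|[set x in W | f x == u]| <= d) ->
  #|W| <= #|B| * d.
Proof.
move=> WB h; rewrite -sum1_card.
rewrite (partition_big f (mem B)) //= -sum_nat_const; apply: leq_sum => u uB.
apply: leq_trans (h u uB); rewrite -sum1_card; apply: eq_leq.
by apply: eq_bigl => x; rewrite inE.
Qed.

(** Cauchy-Schwarz for the fibre sizes [c i], by summing [2 * (c i * c j) <= c i ^ 2 + c j ^ 2] over
    all [i] and [j]. *)
Lemma sqr_card_le_collisions (T K : finType) (f : T -> K) (S : {set T}) :
  #|S| ^ 2 <= #|K| *
    #|[set z : T * T | [&& z.1 \in S, z.2 \in S & f z.1 == f z.2]]|.
Proof.
pose c i := #|[set x in S | f x == i]|.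
have eS : #|S| = \sum_i c i.
  rewrite -sum1_card (partition_big f predT) //=; apply: eq_bigr => i _.
  by rewrite /c -sum1_card; apply: eq_bigl => x; rewrite inE.
have eZ : #|[set z : T * T | [&& z.1 \in S, z.2 \in S & f z.1 == f z.2]]|
    = \sum_i c i ^ 2.
  rewrite -sum1_card (partition_big (fun z => f z.1) predT) //=.
  apply: eq_bigr => i _; rewrite -mulnn /c -cardsX -sum1_card.
  apply: eq_bigl => -[x y]; rewrite !inE /=.
  by case: (x \in S) => //=; case: (y \in S); rewrite /= ?andbF //
    andbC; case: eqP => // ->; rewrite eq_sym.
rewrite eZ eS -mulnn big_distrlr /=.
rewrite -(leq_pmul2l (isT : 0 < 2)).
have -> : 2 * (#|K| * \sum_i c i ^ 2) = \sum_i \sum_j (c i ^ 2 + c j ^ 2).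
  under [RHS]eq_bigr do rewrite big_split /= sum_nat_const.
  rewrite big_split /= sum_nat_const -big_distrr /= addnn.
  by rewrite mul2n.
rewrite big_distrr /=; apply: leq_sum => i _.
rewrite big_distrr /=; apply: leq_sum => j _.
exact: (nat_Cauchy (c i) (c j)).1.
Qed.

(** The index is the rank among the points of [A], divided by [k]. Ranks are distinct on [A];
    outside [A] they may reach [#|A|], which the last block still covers. *)
Lemma block_index (I : finType) (R : realDomainType) (x : I -> R)
    (A : {set I}) (k : nat) :
  0 < k -> {in A &, injective x} ->
  exists idx : I -> 'I_(#|A| %/ k).+1,
    (forall a b, (x a <= x b)%R -> idx a <= idx b) /\
    (forall i, #|[set a in A | idx a == i]| <= k).
Proof.
move=> k0 x_inj.
pose rk a := #|[set b in A | (x b < x a)%R]|.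
have rk_le a : rk a <= #|A|.
  by apply: subset_leq_card; apply/subsetP => b; rewrite inE => /andP[].
have rk_lt a b : a \in A -> (x a < x b)%R -> rk a < rk b.
  move=> aA ab; apply: proper_card; apply/properP; split.
    apply/subsetP => c; rewrite !inE => /andP[-> ca]; exact: lt_trans ca ab.
  by exists a; rewrite !inE aA ?ab ?ltxx.
have rk_inj : {in A &, injective rk}.
  move=> a b aA bA e; apply: x_inj => //; apply/eqP.
  by case: ltgtP => // /rk_lt => [/(_ aA)|/(_ bA)]; rewrite e ltnn.
exists (fun a => inord (rk a %/ k)); split=> [a b ab|i].
  rewrite !inordK ?ltnS ?leq_div2r //.
  apply: subset_leq_card; apply/subsetP => c; rewrite !inE => /andP[-> ca].
  exact: lt_le_trans ca ab.
set F := [set a in _ | _].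
have : uniq [seq rk a | a in F].
  rewrite map_inj_in_uniq ?enum_uniq // => a b; rewrite !mem_enum !inE.
  by move=> /andP[aA _] /andP[bA _]; apply: rk_inj.
move/(@uniq_leq_size _ _ (iota (i * k) k)); rewrite size_iota size_map -cardE.
apply=> ? /mapP [a]; rewrite mem_enum !inE => /andP[aA /eqP <-] ->.
rewrite inordK ?ltnS ?leq_div2r // mem_iota leq_divM /=.
by rewrite {1}(divn_eq (rk a) k) ltn_add2l ltn_mod.
Qed.

(** The sum of the coordinates is injective on such a set and stays below [2 * r]. *)
Lemma chain_card (r : nat) (B : {set 'I_r * 'I_r}) :
  (forall c d, c \in B -> d \in B -> c.1 < d.1 -> c.2 <= d.2) ->
  #|B| <= 2 * r.
Proof.
move=> h.
have : uniq [seq (c.1 + c.2)%N | c : 'I_r * 'I_r in B].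
  rewrite map_inj_in_uniq ?enum_uniq // => -[i j] [i' j'].
  rewrite !mem_enum /= => cB dB e.
  case: (ltngtP i i') => hi.
  - by have /= := h _ _ cB dB hi; lia.
  - by have /= := h _ _ dB cB hi; lia.
  - by congr (_, _); apply: val_inj => //=; lia.
move/(@uniq_leq_size _ _ (iota 0 (2 * r))); rewrite size_iota size_map -cardE.
apply=> ? /mapP [[i j] _ ->] /=; rewrite mem_iota /=.
by have := ltn_ord i; have := ltn_ord j; lia.
Qed.

Lemma antichain_card (r : nat) (B : {set 'I_r * 'I_r}) :
  (forall c d, c \in B -> d \in B -> c.1 < d.1 -> d.2 <= c.2) ->
  #|B| <= 2 * r.
Proof.
move=> h; pose f (c : 'I_r * 'I_r) := (c.1, rev_ord c.2).
have f_inj : injective f by move=> [i j] [i' j'] [-> e]; congr (_, _); apply: val_inj => /=;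
    have := ltn_ord j; have := ltn_ord j'; lia.
rewrite -(card_imset _ f_inj); apply: chain_card.
move=> _ _ /imsetP [c cB ->] /imsetP [d dB ->] /= cd.
by apply: leq_sub2l; rewrite ltnS; apply: h cd.
Qed.

(** * Incidences between the grid and the curves *)

Section Counting.
Variables (R : realFieldType) (I K : finType) (pos : I -> R * R).
Variables (A : {set I}) (rho : R) (col : I * I -> K) (k : nat).
Hypothesis pos_inj : injective pos.
Hypothesis pos_neq0 : forall i, pos i != 0%R.
Hypothesis on_circle : forall a, a \in A -> dot (pos a) (pos a) = rho.
Hypothesis upper_half : forall a, a \in A -> (0 < (pos a).2)%R.
Hypothesis k_gt0 : 0 < k.
(** Colours stand for distances, in a form that allows an extra colour for pairs of equal points. *)
Hypothesis colP : forall a p b q, a \in A -> b \in A ->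
  col (a, p) = col (b, q) ->
  sqdist (pos a) (pos p) = sqdist (pos b) (pos q).

Let r := (#|A| %/ k).+1.
Let curve (p q : I) : {set I * I} :=
  [set x | [&& x.1 \in A, x.2 \in A
            & incident (pos p) (pos q) (pos x.1, pos x.2)]].

Lemma abscissa_inj : {in A &, injective (fun a => (pos a).1)}.
Proof.
move=> a b aA bA e; apply: pos_inj.
have := on_circle aA; rewrite -(on_circle bA) /dot e => /addrI.
have := upper_half aA; have := upper_half bA.
rewrite [pos a]surjective_pairing [pos b]surjective_pairing e /= => y0 y0' h.
congr (_, _); nra.
Qed.

(** The signs of the two cross products cut the curve into four pieces. As [dot p a - dot q b] is
    constant, [b] moves monotonically with [a] on each: forwards if the signs agree, backwards
    otherwise. *)
Lemma curve_cells (idx : I -> 'I_r) (p q : I) :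
  (forall a b, ((pos a).1 <= (pos b).1)%R -> idx a <= idx b) ->
  #|[set (idx x.1, idx x.2) | x in curve p q]| <= 8 * r.
Proof.
move=> idx_le.
have idx_lt a b : idx a < idx b -> ((pos a).1 < (pos b).1)%R.
  by move=> h; rewrite ltNge; apply/negP => /idx_le; rewrite leqNgt h.
pose piece s s' := [set x in curve p q |
  ((0 <= cross (pos p) (pos x.1))%R == s) &&
  ((0 <= cross (pos q) (pos x.2))%R == s')].
have dir s a b u : a \in A -> b \in A -> (0 <= cross (pos u) (pos a))%R == s ->
    (0 <= cross (pos u) (pos b))%R == s -> ((pos a).1 < (pos b).1)%R ->
    if s then (dot (pos u) (pos a) < dot (pos u) (pos b))%R
    else (dot (pos u) (pos b) < dot (pos u) (pos a))%R.
  move=> aA bA ca cb ab.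
  have e : dot (pos a) (pos a) = dot (pos b) (pos b) by rewrite !on_circle.
  case: s ca cb => ca cb.
    by apply: dot_lt; rewrite ?upper_half //; [apply/eqP: ca|apply/eqP: cb].
  apply: dot_gt; rewrite ?upper_half //.
    by rewrite ltNge; move/eqP: ca => ->.
  by rewrite ltNge; move/eqP: cb => ->.
have piece_card s s' :
    #|[set (idx x.1, idx x.2) | x in piece s s']| <= 2 * r.
  have mono x y : x \in piece s s' -> y \in piece s s' ->
      idx x.1 < idx y.1 ->
      if s == s' then ((pos x.2).1 < (pos y.2).1)%R
      else ((pos y.2).1 < (pos x.2).1)%R.
    case: x y => [a b] [a' b']; rewrite !inE /=.
    move=> /andP[/and3P[aA bA /eqP i] /andP[ca cb]].
    move=> /andP[/and3P[a'A b'A /eqP i'] /andP[ca' cb']] /idx_lt aa'.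
    rewrite /= in i i'.
    have h := dir s a a' p aA a'A ca ca' aa'.
    have h1 := dir s' b b' q bA b'A cb cb'.
    have h2 := dir s' b' b q b'A bA cb' cb.
    (* With [b = b'], the values of [dot p] at [a] and [a'] would agree, against [h]. *)
    have bb' : (pos b).1 != (pos b').1.
      apply/eqP => /(abscissa_inj bA b'A) eb; move: i'; rewrite -eb => i'.
      by case: (s) h; lra.
    move: bb'; case: ltgtP => // bb' _; [have {h1 h2} := h1 bb' | have {h1 h2} := h2 bb'];
      by case: (s) (s') h => [] []; rewrite /= ?bb'; lra.
  have [ss|ss] := boolP (s == s'); [apply: chain_card|apply: antichain_card];
    move=> _ _ /imsetP [x xP ->] /imsetP [y yP ->] /= xy;
    have := mono _ _ xP yP xy; rewrite ?ss ?(negPf ss) => h;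
    exact: idx_le (ltW h).
have -> : curve p q = (piece true true :|: piece true false) :|:
    (piece false true :|: piece false false).
  apply/setP => x; rewrite !in_setU ![x \in piece _ _]inE.
  by case: (x \in curve p q); case: (_ <= _)%R; case: (_ <= _)%R.
rewrite !imsetU.
have := piece_card true true; have := piece_card true false.
have := piece_card false true; have := piece_card false false.
set a := imset _ _; set b := imset _ _; set c := imset _ _; set d := imset _ _.
have := (leq_card_setU (d :|: c) (b :|: a)).1.
have := (leq_card_setU d c).1; have := (leq_card_setU b a).1.
by lia.
Qed.

Let incidences : {set (I * I) * (I * I)} :=
  [set z | z.2 \in curve z.1.1 z.1.2].
Let degenerate (z : (I * I) * (I * I)) :=
  gap (pos z.1.1) (pos z.1.2) == 0%R.

(** A collision of [(a, p)] and [(b, q)] is read as the point [(a, b)] on the curve of [(p, q)]. *)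
Lemma collisions_le_incidences : (#|A| * #|I|) ^ 2 <= #|K| * #|incidences|.
Proof.
have <- : #|setX A [set: I]| = #|A| * #|I| by rewrite cardsX cardsT.
apply: leq_trans (sqr_card_le_collisions col _) _; rewrite leq_mul2l.
apply/orP; right; set Z := [set z | _].
pose g (z : (I * I) * (I * I)) := ((z.1.2, z.2.2), (z.1.1, z.2.1)).
have g_inj : injective g by move=> [[a p] [b q]] [[a' p'] [b' q']] [-> -> -> ->].
rewrite -(card_imset _ g_inj); apply: subset_leq_card.
apply/subsetP => _ /imsetP [[[a p] [b q]] zZ ->].
move: zZ; rewrite !inE /= !andbT => /and3P [aA bA /eqP ab].
rewrite aA bA /= /incident /gap /=; apply/eqP.
have := colP aA bA ab; have := on_circle aA; rewrite -(on_circle bA).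
by rewrite /sqdist /dot => e1 e2; lra.
Qed.

(** Once [a], [b] and [p] are fixed, [q] lies on a circle about the origin and on a line orthogonal
    to [b]. *)
Lemma card_degenerate :
  #|[set z in incidences | degenerate z]| <= 2 * #|A| ^ 2 * #|I|.
Proof.
set W := [set z in _ | _].
pose f (z : (I * I) * (I * I)) := (z.2, z.1.1).
apply: leq_trans (@card_le_fibers _ _ f W (setX (setX A A) [set: I]) 2 _ _) _;
  last by rewrite !cardsX cardsT; lia.
  by move=> z; rewrite !inE => /andP[/and3P[-> ->]].
move=> [[a b] p]; rewrite !inE /= andbT => /andP[aA bA].
apply: card_le2 => -[[p1 q1] [a1 b1]] [[p2 q2] [a2 b2]] [[p3 q3] [a3 b3]].
rewrite /W !inE /= /degenerate /f /= !xpair_eqE.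
move=> /andP[/andP[/and3P[_ _ /eqP i1] /eqP g1] /andP[/andP[/eqP ? /eqP ?] /eqP ?]].
move=> /andP[/andP[/and3P[_ _ /eqP i2] /eqP g2] /andP[/andP[/eqP ? /eqP ?] /eqP ?]].
move=> /andP[/andP[/and3P[_ _ /eqP i3] /eqP g3] /andP[/andP[/eqP ? /eqP ?] /eqP ?]].
subst; rewrite /= in i1 i2 i3 g1 g2 g3.
have dE (u v : R * R) : dot u v = dot v u by rewrite /dot mulrC [X in (_ + X)%R]mulrC.
rewrite !(dE _ (pos b)) in i1 i2 i3.
have [|||| /pos_inj ->|/pos_inj ->|/pos_inj ->] :=
  @line_circle R (pos b) (pos q1) (pos q2) (pos q3) (pos_neq0 b).
- by rewrite /gap in g1 g2; lra.
- by rewrite /gap in g2 g3; lra.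
- by lra.
- by lra.
- by apply: Or31.
- by apply: Or32.
- by apply: Or33.
Qed.

Lemma card_generic :
  #|[set z in incidences | ~~ degenerate z]|
    <= 64 * #|I| ^ 2 * r + r ^ 2 * k ^ 8.
Proof.
have [idx [idx_le idx_card]] := block_index k_gt0 abscissa_inj.
pose cell (x : I * I) := (idx x.1, idx x.2).
pose P (x : I * I) := (pos x.1, pos x.2).
set W := [set z in _ | _].
(* Pairs of a curve and a cell that it meets. *)
pose V : {set (I * I) * ('I_r * 'I_r)} :=
  [set v | v.2 \in [set cell x | x in curve v.1.1 v.1.2]].
have V_card : #|V| <= #|I| ^ 2 * (8 * r).
  rewrite -mulnn -card_prod -cardsT; apply: (@card_le_fibers _ _ fst) => // pq _.
  apply: leq_trans (curve_cells pq.1 pq.2 idx_le).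
  rewrite -(card_in_imset (f := snd)); last first.
    move=> [v1 v2] [u1 u2]; rewrite !inE /= => /andP[_ /eqP ->] /andP[_ /eqP ->].
    by move=> ->.
  apply: subset_leq_card; apply/subsetP => _ /imsetP [v + ->].
  by rewrite inE => /andP[+ /eqP <-]; rewrite inE.
pose cellmates (z : (I * I) * (I * I)) :=
  [set x in curve z.1.1 z.1.2 | cell x == cell z.2].
(* A pair in [V] carries at most 8 poor incidences. The threshold 8 is the one of
   [independent_extend], which applies to the rich ones. *)
pose poor := [set z in W | #|cellmates z| <= 8].
pose rich := [set z in W | 8 < #|cellmates z|].
have W_le : #|W| <= #|poor| + #|rich|.
  apply: leq_trans (leq_card_setU poor rich).1; apply: subset_leq_card.
  apply/subsetP => z zW.
  by rewrite in_setU [z \in poor]in_set [z \in rich]in_set zW leqNgt orNb.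
have poor_card : #|poor| <= #|V| * 8.
  pose f (z : (I * I) * (I * I)) := (z.1, cell z.2).
  apply: (@card_le_fibers _ _ f) => [z|v _].
    rewrite /poor /W !inE -andbA => /and3P[zc _ _].
    by apply/imsetP; exists z.2 => //; rewrite inE.
  set F := [set z in _ | _].
  case: (set_0Vmem F) => [->|[z0]]; first by rewrite cards0.
  rewrite inE => /andP[z0p /eqP z0v]; move: (z0p); rewrite inE => /andP[_].
  apply: leq_trans; rewrite -(card_in_imset (f := snd)); last first.
    move=> z z'; rewrite !inE => /andP[_ /eqP zv] /andP[_ /eqP zv'].
    move: zv'; rewrite -zv => -[e _ _].
    by case: z z' e {zv} => [z1 z2] [z1' z2'] /= -> ->.
  apply: subset_leq_card; apply/subsetP => _ /imsetP [z + ->].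
  rewrite inE => /andP[+ /eqP zv]; move: zv; rewrite -z0v => -[e e1 e2].
  rewrite /poor /W inE => /andP[+ _]; rewrite inE => /andP[+ _].
  by rewrite inE e => zc; rewrite /cellmates inE zc /cell e1 e2 eqxx.
pose quad := (((I * I) * (I * I)) * ((I * I) * (I * I)))%type.
pose B : {set quad} := [set t |
  all (fun x => [&& x.1 \in A, x.2 \in A & cell x == cell t.1.1])
    [:: t.1.1; t.1.2; t.2.1; t.2.2]].
have cell_card c :
    #|[set x | [&& x.1 \in A, x.2 \in A & cell x == c]]| <= k ^ 2.
  case: c => i j; rewrite -mulnn.
  apply: leq_trans (leq_mul (idx_card i) (idx_card j)).
  rewrite -cardsX; apply: subset_leq_card; apply/subsetP => x.
  rewrite !inE /cell xpair_eqE => /and3P[-> ->] /andP[-> ->] //.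
have B_card : #|B| <= r ^ 2 * k ^ 8.
  have -> : r ^ 2 = #|[set: 'I_r * 'I_r]| by rewrite cardsT card_prod card_ord.
  apply: (@card_le_fibers _ _ (fun t : quad => cell t.1.1)) => // c _.
  set C := [set x | [&& x.1 \in A, x.2 \in A & cell x == c]].
  have -> : k ^ 8 = (k ^ 2 * k ^ 2) * (k ^ 2 * k ^ 2) by rewrite -!expnD.
  apply: leq_trans (_ : #|setX (setX C C) (setX C C)| <= _); last first.
    by rewrite !cardsX !leq_mul ?cell_card.
  apply: subset_leq_card; apply/subsetP => -[[x0 x1] [x2 x3]].
  rewrite inE /= => /andP[+ /eqP tc]; rewrite inE /= tc.
  by move=> /and5P[h1 h2 h3 h4 _]; rewrite !in_setX !in_set tc h1 h2 h3 h4.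
(* Generic curves with four independent points in one cell. The quadruple determines the curve, so
   [TT] injects into [B]; keeping only the curve and the first point covers [rich]. *)
pose TT : {set (I * I) * quad} := [set t |
  [&& generic (pos t.1.1) (pos t.1.2), t.2 \in B,
      all (fun x => x \in curve t.1.1 t.1.2)
        [:: t.2.1.1; t.2.1.2; t.2.2.1; t.2.2.2]
    & independent (P t.2.1.1) (P t.2.1.2) (P t.2.2.1) (P t.2.2.2)]].
have curve_inc p q x : x \in curve p q -> incident (pos p) (pos q) (P x).
  by rewrite inE => /and3P[].
have TT_card : #|TT| <= #|B|.
  rewrite -[X in _ <= X]muln1; apply: (@card_le_fibers _ _ snd) => [t|u _].
    by rewrite inE => /and4P[].
  rewrite leqNgt; apply/negP => /card_gt1P [[[p q] t] [[[p' q'] t']] []].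
  rewrite inE => /andP[+ /= /eqP tu]; rewrite {t}tu inE /=.
  move=> /and4P[g _ h ind].
  rewrite inE => /andP[+ /= /eqP tu]; rewrite {t'}tu inE /=.
  move=> /and4P[g' _ h' _] /negP; apply.
  move: h h'; rewrite !andbT => /and4P[h0 h1 h2 h3] /and4P[h0' h1' h2' h3'].
  suff [/pos_inj -> /pos_inj ->] : (pos p, pos q) = (pos p', pos q') by [].
  by apply: independent_curve_unique ind g g' _ _; rewrite /= !curve_inc.
have rich_card : #|rich| <= #|TT|.
  pose g (t : (I * I) * quad) := (t.1, t.2.1.1).
  apply: leq_trans (leq_imset_card g TT); apply: subset_leq_card.
  apply/subsetP => -[[p q] x0]; rewrite inE => /andP[zW zr].
  have gpq : generic (pos p) (pos q).
    rewrite /generic !pos_neq0 /=.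
    by move: zW; rewrite inE => /andP[_].
  have x0c : x0 \in curve p q.
    by move: zW; rewrite inE => /andP[+ _]; rewrite inE.
  have P_inj : injective P by move=> [? ?] [? ?] [/pos_inj -> /pos_inj ->].
  have [|||_ [_ [_ [/mapP[x1 + ->] /mapP[x2 + ->] /mapP[x3 + ->]]]] ind] :=
    independent_extend (s := [seq P x | x in cellmates (p, q, x0)]) (rho := rho)
     (P x0) gpq.
  - by rewrite map_inj_uniq ?enum_uniq.
  - by rewrite size_map -cardE.
  - move=> _ /mapP [x + ->]; rewrite mem_enum inE => /andP[xc _].
    split; last exact: curve_inc.
    + by apply: on_circle; move: xc; rewrite inE => /and3P[].
    + by apply: on_circle; move: xc; rewrite inE => /and3P[].
  rewrite !mem_enum ![_ \in cellmates _]in_set /=.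
  move=> /andP[c1 e1] /andP[c2 e2] /andP[c3 e3].
  apply/imsetP; exists ((p, q), ((x0, x1), (x2, x3))) => //.
  have curveA x : x \in curve p q -> x.1 \in A /\ x.2 \in A.
    by rewrite inE => /and3P[].
  rewrite in_set /= gpq ind x0c c1 c2 c3 in_set /= (eqP e1) (eqP e2) (eqP e3).
  by case: (curveA _ x0c) (curveA _ c1) (curveA _ c2) (curveA _ c3) =>
    [-> ->] [-> ->] [-> ->] [-> ->]; rewrite eqxx.
apply: leq_trans W_le _.
have := leq_trans rich_card (leq_trans TT_card B_card).
by lia.
Qed.

Theorem card_le_collisions :
  (#|A| * #|I|) ^ 2 <=
  #|K| * (2 * #|A| ^ 2 * #|I| + 64 * #|I| ^ 2 * r + r ^ 2 * k ^ 8).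
Proof.
apply: leq_trans collisions_le_incidences _; rewrite leq_mul2l.
apply/orP; right; rewrite -addnA.
apply: leq_trans (leq_add card_degenerate card_generic).
apply: leq_trans (leq_card_setU _ _).1; apply: subset_leq_card.
apply/subsetP => z zW; rewrite in_setU.
by rewrite [X in X || _]in_set [X in _ || X]in_set zW orbN.
Qed.
End Counting.

End Combinatorics.

(* Application to a circle and a finite set in the plane *)
From mathcomp Require Import finmap all_classical all_reals all_analysis.
Import numFieldNormedType.Exports.

Lemma card_fset_le (T : choiceType) (I : finType) (f : I -> T) (F : {fset T})
    (S : {set I}) :
  (forall x, x \in F -> exists2 i, i \in S & f i = x) -> (#|` F|%fset <= #|S|)%N.
Proof.
move=> h; rewrite [#|S|]cardE -(size_map f).
apply: uniq_leq_size => // x /h [i iS <-].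
by rewrite map_f // mem_enum.
Qed.

Lemma eucl_distE (R : realType) (p q : R * R) :
  eucl_dist p q = Num.sqrt (sqdist p q).
Proof. by []. Qed.

Lemma sqdist_ge0 (R : realFieldType) (p q : R * R) : 0 <= sqdist p q.
Proof. by rewrite addr_ge0 ?sqr_ge0. Qed.

Section HeavyCircle.
Variables (R : realType) (P : {fset R * R}) (o : R * R) (rad : R) (k : nat).
Hypotheses (rad_gt0 : 0 < rad) (k_gt0 : (0 < k)%N).

(** Removing the centre makes all recentred points nonzero. The sign [s], 1 or -1, reflects the
    lower half circle onto the upper one. *)
Let I : finType := (P `\ o)%fset.
Let recentre (s : R) (i : I) : R * R :=
  ((val i).1 - o.1, s * ((val i).2 - o.2)).

Let on_circ (i : I) := eucl_dist (val i) o == rad.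

Let arc (s : R) : {set I} := [set i : I | on_circ i && (0 < (recentre s i).2)]%SET.

Lemma half_circle_bound (s : R) : s ^+ 2 = 1 ->
  ((#|arc s| * #|I|) ^ 2 <= (num_distances P).+1 *
   (2 * #|arc s| ^ 2 * #|I| + 64 * #|I| ^ 2 * (#|arc s| %/ k).+1 +
    (#|arc s| %/ k).+1 ^ 2 * k ^ 8))%N.
Proof.
move=> s2.
have s0 : s != 0 by apply/eqP => s0; move: s2; rewrite s0 expr0n => /eqP;
  rewrite eq_sym oner_eq0.
(* [None] is the colour of a point paired with itself, since 0 is not among the distances; hence the
   successor in the bound. *)
pose col (x : I * I) : option (distances P) :=
  insub (eucl_dist (val x.1) (val x.2)).
have -> : (num_distances P).+1 = #|{: option (distances P)}|.
  by rewrite card_option -cardfE.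
have sqdistE i j : sqdist (recentre s i) (recentre s j) = sqdist (val i) (val j).
  rewrite /sqdist /= -mulrBr exprMn s2 mul1r; ring.
have mem_dist (i j : I) : i != j -> eucl_dist (val i) (val j) \in distances P.
  move=> ij; apply/imfset2P; exists (val i).
    by have := valP i; rewrite !inE => /andP[].
  exists (val j) => //; rewrite !inE /=.
  by have := valP j; rewrite !inE => /andP[_ ->]; rewrite eq_sym (inj_eq val_inj).
apply: (@card_le_collisions _ _ _ (recentre s) _ (rad ^+ 2) col) => //.
- move=> i j [e1 /(mulfI s0) e2]; apply: val_inj.
  rewrite [val i]surjective_pairing [val j]surjective_pairing.
  by congr (_, _); lra.
- move=> i; apply/eqP => -[e1 /eqP].
  rewrite mulf_eq0 (negPf s0) subr_eq0 /= => /eqP e2.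
  have := valP i; rewrite !inE => /andP[/eqP + _]; apply.
  by rewrite [val i]surjective_pairing [RHS]surjective_pairing e2; congr (_, _); lra.
- move=> a; rewrite inE => /andP[/eqP <- _].
  rewrite eucl_distE sqr_sqrtr ?sqdist_ge0 //.
  rewrite /dot /sqdist /=.
  transitivity (((val a).1 - o.1) ^+ 2 + s ^+ 2 * ((val a).2 - o.2) ^+ 2); first by ring.
  by rewrite s2; ring.
- by move=> a; rewrite inE => /andP[].
- move=> a p b q _ _; rewrite !sqdistE /col /=.
  have dist0 i : sqdist (val i) (val i) = 0 by rewrite /sqdist !subrr expr0n addr0.
  have nmem (i j : I) : eucl_dist (val i) (val j) \notin distances P -> i = j.
    by move=> h; apply/eqP; apply: contraNT h; apply: mem_dist.
  case: insubP => [u _ eu|/nmem ->]; case: insubP => [v _ ev|/nmem ->] //.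
    move=> [] /(congr1 val); rewrite /= eu ev !eucl_distE => /eqP.
    by rewrite eqr_sqrt ?sqdist_ge0 // => /eqP.
  by rewrite !dist0.
Qed.

(** These are the points that both open half circles miss. *)
Lemma card_horizontal_le2 :
  (#|[set i : I | on_circ i && ((val i).2 == o.2)]%SET| <= 2)%N.
Proof.
apply: card_le2 => i j l; rewrite !inE.
move=> /andP[/eqP ci /eqP hi] /andP[/eqP cj /eqP hj] /andP[/eqP cl /eqP hl].
have norm x : eucl_dist (val x) o = rad -> dot (recentre 1 x) (recentre 1 x) = rad ^+ 2.
  move=> <-; rewrite eucl_distE sqr_sqrtr ?sqdist_ge0 //.
  by rewrite /dot /sqdist /=; ring.
have inj x y : recentre 1 x = recentre 1 y -> x = y.
  move=> [e1 /(mulfI (oner_neq0 _)) e2]; apply: val_inj.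
  rewrite [val x]surjective_pairing [val y]surjective_pairing.
  by congr (_, _); lra.
have w0 : ((0, 1) : R * R) != 0 by rewrite xpair_eqE oner_eq0 andbF.
have [|||| /inj ->|/inj ->|/inj ->] :=
  @line_circle R (0, 1) (recentre 1 i) (recentre 1 j) (recentre 1 l) w0.
- by rewrite !norm.
- by rewrite !norm.
- by rewrite /dot /= hi hj !mul0r.
- by rewrite /dot /= hj hl !mul0r.
- by apply: Or31.
- by apply: Or32.
- by apply: Or33.
Qed.

(** Here [m] counts the fuller open half circle, and [n] the points other than the centre. *)
Lemma heavy_circle_bound : exists m n : nat,
  [/\ (num_points_on P (circle o rad) <= 2 * m + 2)%N,
      (n <= #|` P|%fset <= n.+1)%N &
      ((m * n) ^ 2 <= (num_distances P).+1 *
        (2 * m ^ 2 * n + 64 * n ^ 2 * (m %/ k).+1 + (m %/ k).+1 ^ 2 * k ^ 8))%N].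
Proof.
have cardI : (#|I| <= #|` P|%fset <= #|I|.+1)%N.
  rewrite -cardfE (cardfsD1 o P) /=; by case: (o \in P); rewrite /= ?leqnn ?leqnSn.
have pts : (num_points_on P (circle o rad) <= #|arc 1| + #|arc (-1)| + 2)%N.
  set E := [set i : I | on_circ i && ((val i).2 == o.2)]%SET.
  apply: leq_trans (_ : #|(arc 1 :|: arc (-1)) :|: E|%SET <= _)%N; last first.
    have := card_horizontal_le2; rewrite -/E.
    have := (leq_card_setU (arc 1 :|: arc (-1))%SET E).1.
    have := (leq_card_setU (arc 1) (arc (-1))).1.
    by lia.
  apply: (@card_fset_le _ _ (fun i : I => val i)) => x.
  rewrite !inE => /andP[xP /set_mem xC].
  have xI : x \in (P `\ o)%fset.
    rewrite !inE xP andbT; apply/eqP => xo; move: xC; rewrite /circle /= xo.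
    rewrite /eucl_dist !subrr expr0n addr0 sqrtr0 => r0.
    by move: rad_gt0; rewrite -r0 ltxx.
  exists [` xI]%fset => //; rewrite !inE /on_circ /=.
  have -> /= : eucl_dist x o == rad by apply/eqP.
  rewrite mul1r mulN1r oppr_gt0 subr_gt0 subr_lt0.
  by case: ltgtP.
have [h|h] := leqP #|arc (-1)| #|arc 1|.
  exists #|arc 1|, #|I|; split => //; first by lia.
  by apply: half_circle_bound; rewrite expr1n.
exists #|arc (-1)|, #|I|; split => //; first by lia.
by apply: half_circle_bound; rewrite sqrrN expr1n.
Qed.
End HeavyCircle.

(** * Choice of the block size and asymptotics *)

Lemma few_distances_asymptotics (R : realType) (c : R) : 0 < c ->
  exists (delta : R) (n0 : nat), 0 < delta /\
    forall N D M : nat, (n0 <= N)%N -> D%:R <= delta * N%:R ->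
    c * N%:R `^ (5 / 6) <= M%:R ->
    exists2 k : nat, (0 < k)%N &
    forall m n : nat, (M <= 2 * m + 2)%N -> (n <= N <= n.+1)%N ->
    ~~ ((m * n) ^ 2 <= D.+1 *
        (2 * m ^ 2 * n + 64 * n ^ 2 * (m %/ k).+1 + (m %/ k).+1 ^ 2 * k ^ 8))%N.
Proof.
move=> c0.
(* [C] serves in [n <= C * (m * k)], and [L] is twice the factor in
   [n <= (D + 1) * (10 + 128 * C)]. *)
pose C := 8 / c; pose L := 20 + 256 * C.
have C0 : 0 < C by rewrite divr_gt0.
have L0 : 0 < L by rewrite /L; lra.
(* A lower bound for [N ^ (1/6)] that makes [m] dominate both the additive 2 and the block size. *)
pose s0 : R := 1 + 4 / c.
have s0_gt1 : 1 < s0 by rewrite /s0 ltrDl divr_gt0.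
have cs0 : 4 <= c * s0 by rewrite /s0 mulrDr mulr1 mulrC divfK ?gt_eqF // lerDr ltW.
exists (1 / (2 * L)), (Num.truncn (s0 ^+ 6 + 2 * L + 2)).+1.
split; first by rewrite divr_gt0 // mulr_gt0.
move=> N D M N_large D_small M_large.
have N_gt : s0 ^+ 6 + 2 * L + 2 < N%:R.
  apply: lt_le_trans (truncnS_gt _) _; by rewrite ler_nat.
pose s : R := N%:R `^ (1 / 6).
have N_ge0 : 0 <= N%:R :> R by [].
have s6 : s ^+ 6 = N%:R.
  by rewrite -powR_mulrn ?powR_ge0 // -powRrM div1r mulVf // powRr1.
have s5 : s ^+ 5 = N%:R `^ (5 / 6).
  by rewrite -powR_mulrn ?powR_ge0 // -powRrM; congr (_ `^ _); field.
have s_ge0 : 0 <= s by apply: powR_ge0.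
have s_gt : s0 < s.
  rewrite -(@ltr_pXn2r _ 6) ?nnegrE //; last by lra.
  by rewrite s6; apply: lt_trans N_gt; lra.
(* With [k] about [N ^ (1/6)] and [k * r] at most [2 * m], the term [r ^ 2 * k ^ 8] is of order
   [m ^ 2 * n]. *)
exists (Num.truncn s).
  by rewrite truncn_gt0; lra.
set k := Num.truncn s => m n Mm /andP[nN Nn]; apply/negP => bound.
have /andP[k_le k_ge] := truncn_itv s_ge0; rewrite -/k in k_le k_ge.
have k_gt0 : (0 < k)%N by rewrite truncn_gt0; lra.
set r := (m %/ k).+1 in bound.
have kr : (k * r <= m + k)%N by rewrite mulnS addnC leq_add2r mulnC leq_divM.
clearbody r k; move: bound kr Mm nN Nn.
rewrite -(ler_nat R) -(ler_nat R (k * r)) -(ler_nat R M) -(ler_nat R n).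
rewrite -(ler_nat R N) !(natrD, natrM, natrX) -[D.+1%:R]natr1 -[n.+1%:R]natr1.
have K1 : 1 <= k%:R :> R by rewrite ler1n.
have [m0 n0 r0] : [/\ 0 <= m%:R :> R, 0 <= n%:R :> R & 0 <= r%:R :> R] by [].
rewrite -natr1 in k_ge.
have D0 : 0 <= D%:R :> R by [].
move: D_small M_large N_gt k_le k_ge K1 m0 n0 r0 D0; rewrite -s5 -s6.
move: (k%:R : R) (m%:R : R) (n%:R : R) (r%:R : R) (D%:R : R) (M%:R : R).
move=> {k_gt0 r D M s5 s6 N_ge0} K {}m {}n r D M.
move=> D_small M_large N_gt k_le k_ge K1 m0 n0 r0 D0 bound kr Mm nN Nn.
have s1 : 1 < s by lra.
have s4 : s <= s ^+ 4 by rewrite -[X in X <= _]expr1 ler_weXn2l // ltW.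
have cs : 4 <= c * s by apply: le_trans cs0 _; rewrite ler_pM2l // ltW.
have s5e : c * s ^+ 5 = (c * s) * s ^+ 4 by ring.
have cs5 : 4 * s ^+ 4 <= c * s ^+ 5.
  by rewrite s5e ler_wpM2r // exprn_ge0.
have m_ge : c * s ^+ 5 <= 4 * m by lra.
have Km : K <= m by lra.
have Kr : K * r <= 2 * m by lra.
(* This combines [c * s ^ 5 <= 4 * m] with [s < K + 1 <= 2 * K]. *)
have n_le : n <= C * (m * K).
  apply: le_trans nN _; rewrite -(ler_pM2l c0) /C.
  have -> : c * (8 / c * (m * K)) = 4 * m * (2 * K) by field; lra.
  have -> : c * s ^+ 6 = (c * s ^+ 5) * s by ring.
  by apply: ler_pM => //; [rewrite mulr_ge0 ?exprn_ge0 // ltW | lra].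
have nr : n * r <= 2 * C * m ^+ 2.
  apply: le_trans (ler_wpM2r r0 n_le) _.
  have -> : C * (m * K) * r = (C * m) * (K * r) by ring.
  have -> : 2 * C * m ^+ 2 = (C * m) * (2 * m) by ring.
  by apply: ler_wpM2l => //; rewrite mulr_ge0 // ltW.
have K6 : K ^+ 6 <= 2 * n.
  apply: le_trans (_ : s ^+ 6 <= _).
    by rewrite ler_pXn2r ?nnegrE //; lra.
  have : 0 <= s0 ^+ 6 by rewrite exprn_ge0 //; lra.
  by lra.
have m_gt0 : 0 < m by lra.
have n_gt0 : 0 < n by have : 0 < K ^+ 6; [rewrite exprn_gt0 //|]; lra.
(* After division by [m ^ 2 * n], the three terms contribute 2, [128 * C] and 8. *)
have n_bound : n <= (D + 1) * (10 + 128 * C).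
  have mn : 0 < m ^+ 2 * n by rewrite mulr_gt0 // exprn_gt0.
  rewrite -(ler_pM2l mn).
  have -> : m ^+ 2 * n * n = (m * n) ^+ 2 by ring.
  apply: le_trans bound _.
  have -> : m ^+ 2 * n * ((D + 1) * (10 + 128 * C)) =
    (D + 1) * (2 * m ^+ 2 * n + (64 * n) * (2 * C * m ^+ 2)
       + (2 * m) ^+ 2 * (2 * n)) by ring.
  apply: ler_wpM2l; first by lra.
  apply: lerD; first apply: lerD => //.
    have -> : 64 * n ^+ 2 * r = (64 * n) * (n * r) by ring.
    by apply: ler_wpM2l => //; lra.
  have -> : r ^+ 2 * K ^+ 8 = (K * r) ^+ 2 * K ^+ 6 by ring.
  have Kr0 : 0 <= K * r by rewrite mulr_ge0 // ltW // (lt_le_trans ltr01).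
  have Kr2 : (K * r) ^+ 2 <= (2 * m) ^+ 2.
    by apply: lerXn2r Kr; rewrite nnegrE // mulr_ge0.
  by apply: ler_pM => //; apply: exprn_ge0 => //; apply: le_trans ler01 K1.
have DL : D * L <= s ^+ 6 / 2.
  rewrite -ler_pdivlMr //; apply: le_trans D_small _.
  by rewrite le_eqVlt; apply/orP; left; apply/eqP; field; lra.
have s06 : 0 <= s0 ^+ 6 by rewrite exprn_ge0 //; lra.
(* Now [2 * n <= D * L + L <= N / 2 + L], whereas [n >= N - 1] and [N > 2 * L + 2]. *)
by rewrite /L in DL N_gt L0; lra.
Qed.

Local Open Scope classical_set_scope.
Local Open Scope ring_scope.

Theorem theorem1p5 (R : realType) (P : nat -> {fset R * R})
  (cardP : forall n : nat, (1 <= n)%N -> #|` P n|%fset = n)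
  (fewP : (fun n : nat => (num_distances (P n))%:R : R)
            =o_\oo (fun n : nat => n%:R : R)) :
  forall c : R, 0 < c ->
    exists n0 : nat, forall n : nat, (n0 <= n)%N ->
      ~ exists (o : R * R) (r : R), 0 < r /\
          c * n%:R `^ (5 / 6) <= (num_points_on (P n) (circle o r))%:R.
Proof.
move=> c c0.
have [delta [n0 [delta0 h]]] := few_distances_asymptotics c0.
have /eqoP/(_ _ delta0) [n1 _ few] := fewP.
exists (maxn 1 (maxn n0 n1)) => n; rewrite !geq_max => /and3P[n_ge1 n_ge0 n_ge1'].
move=> [ctr [rad [rad0 heavy]]].
have few_n : (num_distances (P n))%:R <= delta * n%:R.
  by have := few n n_ge1'; rewrite /= !ger0_norm.
have [k k0 {}h] := h _ _ _ n_ge0 few_n heavy.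
have [m [n' [Mm]]] := heavy_circle_bound (P n) ctr rad0 k0.
by rewrite (cardP _ n_ge1) => nn; apply/negP; apply: h Mm nn.
Qed.
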